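(* Let $G$ be a finite group acting by $\psi$ on a small category $\mathcal C$ in which every sequence of composable non-identity morphisms has length at most some fixed number. Let $F\colon\mathcal C\to\mathrm{Top}_*$ be a homotopy coherent diagram with an external action $\bar\psi$ of $G$ compatible with $\psi$. Then the homotopy colimit $\mathrm{hocolim}\,F$ admits a $G$-action given by $$g\,(f_m,\dots,f_1;t_1,\dots,t_m;y)=(\psi_gf_m,\dots,\psi_gf_1;t_1,\dots,t_m;\bar\psi_g y).$$ Similarly, if $K$ is a finite abelian group and $F\colon\mathcal C\to K\text{-}\mathrm{Top}_*$ admits an external action by $G$, the homotopy colimit in $K\text{-}\mathrm{Top}_*$ inherits a $K\times G$-action by the same formula.
   Context: $\mathrm{Top}_*$ is the category of well-based spaces; $K\text{-}\mathrm{Top}_*$ is the category of well-based spaces with a continuous action of the finite group $K$ (inclusions of fixed-point sets being cofibrations) and equivariant maps. A $G$-action on a small category $\mathcal C$ is an action $\psi$ on objects with bijections $\psi_g\colon\mathrm{Hom}(x,y)\to\mathrm{Hom}(\psi_gx,\psi_gy)$ compatible with composition, identities, and multiplication in $G$. A homotopy coherent diagram $F\colon\mathcal C\to K\text{-}\mathrm{Top}_*$ (the case $K=1$ gives $\mathrm{Top}_*$) assigns to each object $x$ a space $F(x)$ and to each composable sequence $x_0\xrightarrow{f_1}\cdots\xrightarrow{f_n}x_n$, $n\ge1$, a continuous ($K$-equivariant) map $F(f_n,\dots,f_1)\colon[0,1]^{n-1}\times F(x_0)\to F(x_n)$ sending $[0,1]^{n-1}\times\{*\}$ to $*$. In a category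 without non-identity isomorphisms (as here) one may use only non-identity morphisms, and the requirements are: if $t_i=0$, $F(f_n,\dots,f_1)(t_1,\dots,t_{n-1})=F(f_n,\dots,f_{i+1})(t_{i+1},\dots,t_{n-1})\circ F(f_i,\dots,f_1)(t_1,\dots,t_{i-1})$; if $t_i=1$, it equals $F(f_n,\dots,f_{i+1}\circ f_i,\dots,f_1)(t_1,\dots,\hat t_i,\dots,t_{n-1})$. Its homotopy colimit is $$\mathrm{hocolim}\,F=\{*\}\amalg\coprod_{n\ge0}\ \coprod_{x_0\xrightarrow{f_1}\cdots\xrightarrow{f_n}x_n,\ f_i\ne\mathrm{Id}}[0,1]^n\times F(x_0)\Big/\sim,$$ where $(f_n,\dots,f_1;t_1,\dots,t_n;y)$ is identified with $(f_n,\dots,f_{i+1};t_{i+1},\dots,t_n;F(f_i,\dots,f_1)(t_1,\dots,t_{i-1},y))$ if $t_i=0$; with $(f_n,\dots,f_{i+1}\circ f_i,\dots,f_1;t_1,\dots,\hat t_i,\dots,t_n;y)$ if $t_i=1$, $i<n$; with $(f_{n-1},\dots,f_1;t_1,\dots,t_{n-1};y)$ if $t_n=1$; and with $*$ if $y=*$. An external action $\bar\psi$ of $G$ on $F$ compatible with $\psi$ is a homomorphism $\bar\psi\colon G\to\mathrm{Homeo}\big(\bigvee_{c\in\mathrm{Ob}(\mathcal C)}F(c)\big)$, preserving the basepoint and lifting the action of $G$ on $\mathrm{Ob}(\mathcal C)$ (so $\bar\psi_g$ maps $F(c)$ to $F(\psi_gc)$), such that for all $g\in G$ and $y\in F(c)$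 $$\bar\psi_g\big(F(f_i,\dots,f_1)(t_1,\dots,t_{i-1})(y)\big)=F(\psi_gf_i,\dots,\psi_gf_1)(t_1,\dots,t_{i-1})(\bar\psi_gy).$$ For $K\text{-}\mathrm{Top}_*$ one further requires the $K$- and $G$-actions to commute. *)

(* Defs.v *)
From HB Require Import structures.
From mathcomp Require Import all_boot all_order all_algebra all_fingroup.
From mathcomp Require Import generic_quotient.
From mathcomp Require Import all_classical all_reals topology wedge_sigT.
From Stdlib Require Import Relation_Operators Operators_Properties.

Import numFieldTopology.Exports.

Set Implicit Arguments.
Unset Strict Implicit.
Unset Printing Implicit Defensive.

Local Open Scope classical_set_scope.
Local Open Scope ring_scope.
Local Open Scope quotient_scope.

Record category := Category {
  ob :> Type;
  hom : ob -> ob -> Type;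
  idm : forall x, hom x x;
  comp : forall x y z, hom y z -> hom x y -> hom x z;
  comp1m : forall x y (f : hom x y), comp (idm y) f = f;
  compm1 : forall x y (f : hom x y), comp f (idm x) = f;
  compA : forall x y z w (h : hom z w) (g : hom y z) (f : hom x y),
    comp h (comp g f) = comp (comp h g) f }.

Arguments hom {c}.
Arguments idm {c}.
Arguments comp {c x y z}.

HB.instance Definition _ (C : category) := gen_eqMixin (ob C).
HB.instance Definition _ (C : category) := gen_choiceMixin (ob C).

(* Equality of total arrows compares morphisms whose endpoints are only
   provably equal. *)
Definition arrow (C : category) := {x : C & {y : C & hom x y}}.

Definition arr (C : category) (x y : C) (f : hom x y) : arrow C :=
  existT _ x (existT _ y f).

Definition is_id (C : category) (x y : C) (f : hom x y) : Prop :=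
  arr f = arr (idm x).

Record nhom (C : category) (x y : C) := Nhom {
  nval :> hom x y;
  nvalP : ~ is_id nval }.

(* [chain n x y] is the set of composable sequences
   x = x_0 --f_1--> ... --f_n--> x_n = y of non-identity morphisms;
   [f_1] is at the head. *)
Inductive chain (C : category) : nat -> C -> C -> Type :=
| cnil x : chain 0 x x
| ccons n x y z (f : nhom x y) (c : chain n y z) : chain n.+1 x z.

Arguments cnil {C}.
Arguments ccons {C n x y z}.

Fixpoint ccat (C : category) (m n : nat) (x y z : C) (c1 : chain m x y) :
    chain n y z -> chain (m + n) x z :=
  match c1 in chain m x y return chain n y z -> chain (m + n) x z with
  | cnil _ => fun c2 => c2
  | ccons _ _ _ _ f c => fun c2 => ccons f (ccat c c2)
  end.

(* [contracts i c c']: c' is c with the two morphisms at 0-based positions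
   [i] and [i.+1], that is f_{i+1} and f_{i+2}, replaced by their composite.
   When composable sequences of non-identity morphisms have bounded length,
   that composite is never an identity (otherwise the two morphisms could be
   alternated forever), so requiring [h : nhom x z] loses nothing. *)
Inductive contracts (C : category) :
    forall n (x y : C), nat -> chain n.+1 x y -> chain n x y -> Prop :=
| contracts_head n x y z w (f : nhom x y) (g : nhom y z) (h : nhom x z)
    (c : chain n z w) :
    nval h = comp g f -> contracts 0 (ccons f (ccons g c)) (ccons h c)
| contracts_tail n i x y z (e : nhom x y) (c : chain n.+1 y z)
    (c' : chain n y z) :
    contracts i c c' -> contracts i.+1 (ccons e c) (ccons e c').

(* For a finite, hence discrete, group this is a continuous left action. *)
Record top_action (G : finGroupType) (X : topologicalType) (a : G -> X -> X) :
    Prop := TopAction {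
  ta_cont : forall g, continuous (a g);
  ta1 : forall x, a 1%g x = x;
  taM : forall g h x, a (g * h)%g x = a g (a h x) }.

Record cat_action (G : finGroupType) (C : category) := CatAction {
  aob : G -> C -> C;
  aob1 : forall x, aob 1%g x = x;
  aobM : forall g h x, aob (g * h)%g x = aob g (aob h x);
  ahom : forall g x y, hom x y -> hom (aob g x) (aob g y);
  ahom_bij : forall g x y, bijective (@ahom g x y);
  ahom_id : forall g x, ahom g (idm x) = idm (aob g x);
  ahom_comp : forall g x y z (h : hom y z) (f : hom x y),
    ahom g (comp h f) = comp (ahom g h) (ahom g f);
  ahomM : forall g h x y (f : hom x y),
    arr (ahom (g * h)%g f) = arr (ahom g (ahom h f)) }.

Section ChainAction.
Context (G : finGroupType) (C : category) (psi : cat_action G C).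

Lemma aob_inj (g : G) : injective (aob psi g).
Proof.
move=> x y exy; rewrite -(aob1 psi x) -(aob1 psi y) -(mulVg g) !aobM.
by rewrite exy.
Qed.

Lemma ahom_nonid (g : G) (x y : C) (f : hom x y) :
  ~ is_id f -> ~ is_id (ahom psi g f).
Proof.
move=> nf idgf; apply: nf.
have exy : x = y.
  apply: (@aob_inj g).
  by have := congr1 (fun u : arrow C => projT1 (projT2 u)) idgf; rewrite /arr /=.
subst y; suff -> : f = idm x by [].
apply: (bij_inj (ahom_bij psi g x x)); rewrite ahom_id.
exact: existT_inj2 (existT_inj2 idgf).
Qed.

Definition anhom (g : G) (x y : C) (f : nhom x y) :
    nhom (aob psi g x) (aob psi g y) :=
  Nhom (ahom_nonid (g := g) (@nvalP _ _ _ f)).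

Fixpoint achain (g : G) (n : nat) (x y : C) (c : chain n x y) :
    chain n (aob psi g x) (aob psi g y) :=
  match c in chain n x y return chain n (aob psi g x) (aob psi g y) with
  | cnil x => cnil (aob psi g x)
  | ccons _ _ _ _ f c => ccons (anhom g f) (achain g c)
  end.

End ChainAction.

Definition unit_itv (R : realType) : topologicalType :=
  set_type (`[0%R, 1%R]%classic : set R).

Definition cube (R : realType) (n : nat) : topologicalType :=
  prod_topology (fun _ : 'I_n => unit_itv R).

(* The homotopy extension property; only the values of [h] on [A] x [0,1]
   are relevant. *)
Definition cofibration (R : realType) (X : topologicalType) (A : set X) :=
  forall (Z : topologicalType) (f : X -> Z) (h : X * unit_itv R -> Z),
    continuous f -> {within A `*` setT, continuous h} ->
    (forall a s, A a -> set_val s = 0 -> h (a, s) = f a) ->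
    exists H : X * unit_itv R -> Z,
      [/\ continuous H,
          forall x s, set_val s = 0 -> H (x, s) = f x &
          forall a s, A a -> H (a, s) = h (a, s)].

Definition well_based (R : realType) (X : ptopologicalType) :=
  cofibration R [set point : X].

(* The coordinate t_i is [t] at the 0-based index i-1. A sequence with
   [n.+1] morphisms is parametrized by the [n]-cube. *)
Record hc_diagram (R : realType) (C : category) := HcDiagram {
  hc_space :> C -> ptopologicalType;
  hc_wb : forall x, well_based R (hc_space x);
  hc_map : forall n (x y : C),
    chain n.+1 x y -> cube R n -> hc_space x -> hc_space y;
  hc_cont : forall n x y (c : chain n.+1 x y),
    continuous (fun p : cube R n * hc_space x => hc_map c p.1 p.2);
  hc_based : forall n x y (c : chain n.+1 x y) t, hc_map c t point = point;
  hc_zero : forall m n x y z (c1 : chain m.+1 x y) (c2 : chain n.+1 y z)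
      (t : cube R (m + n.+1)) p,
    set_val (t (rshift m ord0)) = 0 ->
    @hc_map (m + n.+1)%N x z (ccat c1 c2) t p =
    hc_map c2 (fun j => t (rshift m (lift ord0 j)))
      (hc_map c1 (fun j => t (lshift n.+1 j)) p);
  hc_one : forall n x y (c : chain n.+2 x y) (c' : chain n.+1 x y)
      (i : 'I_n.+1) (t : cube R n.+1) p,
    contracts i c c' -> set_val (t i) = 1 ->
    hc_map c t p = hc_map c' (fun j => t (lift i j)) p }.

Arguments hc_map {R C} _ {n x y}.

(* The data turning a diagram in well-based spaces into one in well-based
   K-spaces. *)
Record K_structure (K : finGroupType) (R : realType) (C : category)
    (F : hc_diagram R C) := KStructure {
  kact : forall x, K -> F x -> F x;
  kact_action : forall x, top_action (@kact x);
  kact_based : forall x k, @kact x k point = point;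
  kact_cof : forall x (H : {group K}),
    cofibration R [set p : F x | forall k, k \in H -> kact k p = p];
  kact_map : forall n x y (c : chain n.+1 x y) t k p,
    hc_map F c t (kact k p) = kact k (hc_map F c t p) }.

Section External.
Context (G : finGroupType) (R : realType) (C : category).
Context (psi : cat_action G C) (F : hc_diagram R C).

Definition dwedge := wedge (fun c : C => (point : F c)).

Definition in_dwedge (c : C) (p : F c) : dwedge :=
  wedge_lift (fun c : C => (point : F c)) p.

(* [ext_fib] is the map F(c) -> F(psi_g c) induced by [ext_wedge g]; it is
   determined by [ext_fibE], the inclusions into the wedge being injective.
   The basepoint condition is stated on every wedge summand because the
   library's wedge over an empty index has no point. *)
Record external_action := ExternalAction {
  ext_wedge : G -> dwedge -> dwedge;
  ext_action : top_action ext_wedge;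
  ext_based : forall g c, ext_wedge g (in_dwedge (point : F c)) =
                          in_dwedge (point : F c);
  ext_fib : forall g c, F c -> F (aob psi g c);
  ext_fibE : forall g c (p : F c),
    ext_wedge g (in_dwedge p) = in_dwedge (ext_fib g p);
  ext_map : forall g n x y (c : chain n.+1 x y) t (p : F x),
    ext_fib g (hc_map F c t p) = hc_map F (achain psi g c) t (ext_fib g p) }.

End External.

Definition ext_commutes (K G : finGroupType) (R : realType) (C : category)
    (psi : cat_action G C) (F : hc_diagram R C) (kF : K_structure K F)
    (bar : external_action psi F) :=
  forall k g c (p : F c), ext_fib bar g (kact kF k p) = kact kF k (ext_fib bar g p).

Record cell (C : category) := Cell {
  cell_len : nat;
  cell_src : C;
  cell_tgt : C;
  cell_chain : chain cell_len cell_src cell_tgt }.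

HB.instance Definition _ (C : category) := gen_eqMixin (cell C).
HB.instance Definition _ (C : category) := gen_choiceMixin (cell C).

Section Hocolim.
Context (R : realType) (C : category) (F : hc_diagram R C).

(* The index [None] is the added basepoint. *)
Definition hc_cell (i : option (cell C)) : topologicalType :=
  match i with
  | None => discrete_topology unit
  | Some s => (cube R (cell_len s) * F (cell_src s))%type
  end.

Definition hc_total : topologicalType := {i & hc_cell i}.

Definition hc_total_base : hc_total := existT hc_cell None tt.

Definition hc_total_pt n (x y : C) (c : chain n x y) (t : cube R n) (p : F x) :
    hc_total :=
  existT hc_cell (Some (Cell c)) (t, p).

Inductive hc_rel : hc_total -> hc_total -> Prop :=
| hc_rel_zero m n x y z (c1 : chain m.+1 x y) (c2 : chain n y z)
    (t : cube R (m.+1 + n)) (p : F x) :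
    set_val (t (lshift n ord_max)) = 0 ->
    hc_rel (hc_total_pt (ccat c1 c2) t p)
      (hc_total_pt c2 (fun j => t (rshift m.+1 j))
         (hc_map F c1 (fun j => t (lshift n (widen_ord (leqnSn m) j))) p))
| hc_rel_one n x y (c : chain n.+1 x y) (c' : chain n x y) (i : 'I_n.+1)
    (t : cube R n.+1) (p : F x) :
    contracts i c c' -> set_val (t i) = 1 ->
    hc_rel (hc_total_pt c t p) (hc_total_pt c' (fun j => t (lift i j)) p)
| hc_rel_last n x y z (c : chain n x y) (f : nhom y z)
    (t : cube R (n + 1)) (p : F x) :
    set_val (t (rshift n ord0)) = 1 ->
    hc_rel (hc_total_pt (ccat c (ccons f (cnil z))) t p)
      (hc_total_pt c (fun j => t (lshift 1 j)) p)
| hc_rel_base n x y (c : chain n x y) (t : cube R n) :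
    hc_rel (hc_total_pt c t point) hc_total_base.

Definition hc_eqb (a b : hc_total) : bool :=
  `[< clos_refl_sym_trans _ hc_rel a b >].

Lemma hc_eqb_refl : reflexive hc_eqb.
Proof. by move=> a; apply/asboolP; apply: rst_refl. Qed.

Lemma hc_eqb_sym : symmetric hc_eqb.
Proof. by move=> a b; apply/asboolP/asboolP; apply: rst_sym. Qed.

Lemma hc_eqb_trans : transitive hc_eqb.
Proof.
by move=> b a c /asboolP ab /asboolP bc; apply/asboolP; apply: rst_trans bc.
Qed.

Definition hc_equiv := EquivRel hc_eqb hc_eqb_refl hc_eqb_sym hc_eqb_trans.

Definition hocolim : topologicalType := quotient_topology {eq_quot hc_equiv}.

Definition hc_base : hocolim := \pi_({eq_quot hc_equiv}) hc_total_base.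

(* The class of (f_n, ..., f_1; t_1, ..., t_n; p). *)
Definition hc_pt n (x y : C) (c : chain n x y) (t : cube R n) (p : F x) :
    hocolim :=
  \pi_({eq_quot hc_equiv}) (hc_total_pt c t p).

End Hocolim.

Arguments hc_base {R C}.
Arguments hc_pt {R C} F {n x y}.

(* Main.v *)
(* Each generator of the gluing relation on cells is preserved by the formula,
   since [g] acts functorially on chains and intertwines the structure maps;
   so the formula descends to the quotient. Associativity and unit hold only
   up to transport between fibres over equal objects, and equality inside the
   wedge is what expresses them. *)
Require Import Defs.
From mathcomp Require Import all_boot all_order all_algebra all_fingroup.
From mathcomp Require Import all_classical all_reals topology.
From mathcomp Require Import generic_quotient wedge_sigT.
From Stdlib Require Import Relation_Operators Operators_Properties.

Set Implicit Arguments.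
Unset Strict Implicit.
Unset Printing Implicit Defensive.

Local Open Scope quotient_scope.

(** * Chains compared across provably equal endpoints *)

Section Chains.
Context (C : category).

(** The laws of [psi] on objects are only propositional, so chains such as [achain psi 1 c] and [c]
    have different types; bundling the endpoints lets them be equated without casts. *)
Definition total_chain n (x y : C) (c : chain n x y) :
    {x : C & {y : C & chain n x y}} :=
  existT _ x (existT _ y c).

Lemma arr_inj (x y : C) : injective (@arr C x y).
Proof. by move=> f f' e; exact: existT_inj2 (existT_inj2 e). Qed.

Lemma total_chain_inj n (x y : C) : injective (@total_chain n x y).
Proof. by move=> c c' e; exact: existT_inj2 (existT_inj2 e). Qed.

Lemma nval_inj (x y : C) : injective (@nval C x y).
Proof.
by move=> [f nf] [f' nf'] /= ef; case: _ / ef nf' => nf'; congr Nhom.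
Qed.

Lemma total_chain_cons n (x y z x' y' z' : C) (f : nhom x y) (f' : nhom x' y')
    (c : chain n y z) (c' : chain n y' z') :
  arr f = arr f' -> total_chain c = total_chain c' ->
  total_chain (ccons f c) = total_chain (ccons f' c').
Proof.
move=> ef ec; have ex : x = x' := congr1 (@projT1 _ _) ef.
have ey : y = y' := congr1 (@projT1 _ _) ec.
have ez : z = z' := congr1 (fun u => projT1 (projT2 u)) ec.
subst x' y' z'; move/arr_inj/nval_inj: ef => <-.
by rewrite (total_chain_inj ec).
Qed.

End Chains.

(** * Functoriality of the action on chains *)

Section ChainAction.
Context (G : finGroupType) (C : category) (psi : cat_action G C).

Lemma achain_cat g m n (x y z : C) (c1 : chain m x y) (c2 : chain n y z) :
  achain psi g (ccat c1 c2) = ccat (achain psi g c1) (achain psi g c2).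
Proof. by elim: c1 c2 => //= {}m {}x {}y w f c IH c2; rewrite IH. Qed.

Lemma achain_contracts g n (x y : C) i (c : chain n.+1 x y) (c' : chain n x y) :
  contracts i c c' -> contracts i (achain psi g c) (achain psi g c').
Proof.
elim=> {n x y i c c'} [n x y z w f f' h d eh|n i x y z e d d' _ IH] /=.
  by apply: contracts_head; rewrite /= eh ahom_comp.
exact: contracts_tail.
Qed.

Lemma arr_ahom_inj g (x y x' y' : C) (f : Defs.hom x y) (f' : Defs.hom x' y') :
  arr (ahom psi g f) = arr (ahom psi g f') -> arr f = arr f'.
Proof.
move=> e; have ex : x = x' := aob_inj (congr1 (@projT1 _ _) e).
have ey : y = y' := aob_inj (congr1 (fun u : arrow C => projT1 (projT2 u)) e).
subst x' y'; congr arr; exact: bij_inj (ahom_bij psi g x y) _ _ (arr_inj e).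
Qed.

(** The unit law on morphisms is not a field of [cat_action]: it comes from cancelling one $\psi_1$
    in $\psi_1\psi_1=\psi_{1\cdot 1}=\psi_1$. *)
Lemma arr_ahom1 (x y : C) (f : Defs.hom x y) : arr (ahom psi 1%g f) = arr f.
Proof. by apply: (@arr_ahom_inj 1%g); rewrite -ahomM mulg1. Qed.

Lemma total_achain1 n (x y : C) (c : chain n x y) :
  total_chain (achain psi 1%g c) = total_chain c.
Proof.
elim: c => [{}x|{}n {}x {}y z f c IH] /=; first by rewrite aob1.
by apply: total_chain_cons IH; exact: arr_ahom1.
Qed.

Lemma total_achainM g h n (x y : C) (c : chain n x y) :
  total_chain (achain psi (g * h)%g c) =
  total_chain (achain psi g (achain psi h c)).
Proof.
elim: c => [{}x|{}n {}x {}y z f c IH] /=; first by rewrite aobM.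
by apply: total_chain_cons IH; exact: ahomM.
Qed.

End ChainAction.

(** * Equality in the wedge and in the homotopy colimit *)

Section Wedge.
Context (R : realType) (C : category) (F : hc_diagram R C).

Lemma in_dwedge_eq (c c' : C) (p : F c) (p' : F c') :
  in_dwedge p = in_dwedge p' ->
  existT (hc_space F) c p = existT (hc_space F) c' p' \/
  p = point /\ p' = point.
Proof.
move=> /eqmodP/predU1P[e|/andP[/eqP/= -> /eqP/= ->]]; last by right.
by left.
Qed.

Lemma in_dwedge_point (c c' : C) :
  in_dwedge (point : F c) = in_dwedge (point : F c').
Proof. exact: (@wedge_liftE C (hc_space F) (fun=> point) _ point _ point). Qed.

Lemma in_dwedge_inj (c : C) : injective (@in_dwedge R C F c).
Proof. by move=> p p' /in_dwedge_eq[e|[-> ->] //]; exact: existT_inj2 e. Qed.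

Lemma hc_pt_point n (x y : C) (c : chain n x y) (t : cube R n) :
  hc_pt F c t point = hc_base F.
Proof. by apply/eqmodP/asboolP/rst_step/hc_rel_base. Qed.

(** This criterion turns the action laws into laws on chains and on the wedge. Away from the
    basepoint, equality in the wedge forces equality in the same fibre; at the basepoint the fibres
    may differ, but both cells collapse to [hc_base]. *)
Lemma eq_hc_pt n (x y x' y' : C) (c : chain n x y) (c' : chain n x' y')
    (t : cube R n) (p : F x) (p' : F x') :
  total_chain c = total_chain c' -> in_dwedge p = in_dwedge p' ->
  hc_pt F c t p = hc_pt F c' t p'.
Proof.
move=> ec /in_dwedge_eq[ep|[-> ->]]; last by rewrite !hc_pt_point.
have ex : x = x' := congr1 (@projT1 _ _) ec.
have ey : y = y' := congr1 (fun u => projT1 (projT2 u)) ec.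
subst x' y'; rewrite -(total_chain_inj ec).
by rewrite (existT_inj2 ep).
Qed.

Lemma hocolim_ind (P : hocolim F -> Prop) :
  P (hc_base F) ->
  (forall n (x y : C) (c : chain n x y) (t : cube R n) (p : F x),
     P (hc_pt F c t p)) ->
  forall u, P u.
Proof.
move=> Pb Pp u; rewrite -[u](@reprK _ {eq_quot hc_equiv F}).
by case: (repr _) => -[[n x y c] [t p]|[]]; [exact: Pp|exact: Pb].
Qed.

End Wedge.

(** * Descent of a cellwise action to the quotient *)

Section Descent.
Context (R : realType) (G A : finGroupType) (C : category).
Context (psi : cat_action G C) (F : hc_diagram R C) (q : A -> G).
Context (phi : forall a c, F c -> F (aob psi (q a) c)).
Hypothesis q1 : q 1%g = 1%g.
Hypothesis qM : forall a b, q (a * b)%g = (q a * q b)%g.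
Hypothesis phi_cont : forall a c, continuous (@phi a c).
Hypothesis phi_based : forall a c, @phi a c point = point.
Hypothesis phi_map : forall a n x y (c : chain n.+1 x y) t (p : F x),
  phi a (hc_map F c t p) = hc_map F (achain psi (q a) c) t (phi a p).
Hypothesis phi1 : forall c (p : F c), in_dwedge (phi 1%g p) = in_dwedge p.
Hypothesis phiM : forall a b c (p : F c),
  in_dwedge (phi (a * b)%g p) = in_dwedge (phi a (phi b p)).

(** The acting group [A] moves chains only through [q : A -> G], so that the cases $A=G$ with the
    identity and $A=K\times G$ with the second projection are treated at once. *)
Definition cell_map (a : A) (i : option (cell C)) : hc_cell F i -> hc_total F :=
  match i return hc_cell F i -> hc_total F with
  | None => fun _ => hc_total_base F
  | Some s => fun z => hc_total_pt (achain psi (q a) (cell_chain s)) z.1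
                         (phi a z.2)
  end.

Definition total_map (a : A) : hc_total F -> hc_total F :=
  fun u => cell_map a (projT2 u).

Lemma total_map_continuous a : continuous (total_map a).
Proof.
apply: (@sigT_continuous _ _ _ (@cell_map a)) => -[s|]; last first.
  exact: cst_continuous.
move=> z; rewrite /cell_map/= /hc_total_pt.
(* On one summand the map factors through the single cell of the translated chain, followed by its
   inclusion into the sum. *)
apply: (@continuous_comp _ _ _
  (fun z : hc_cell F (Some s) => (z.1, phi a z.2) :
     hc_cell F (Some (Cell (achain psi (q a) (cell_chain s)))))
  (existT (hc_cell F) _)); last exact: existT_continuous.
apply: (@cvg_pair _ _ _ _ (nbhs z.1) (nbhs (phi a z.2))); first exact: cvg_fst.
apply: (@continuous_comp _ _ _ snd (@phi a (cell_src s))); first exact: cvg_snd.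
exact: phi_cont.
Qed.

(** The cube coordinates are untouched, so the conditions $t_i=0$ and $t_i=1$ carry over, and each
    generator goes to one of the same kind. *)
Lemma total_map_rel a u v :
  hc_rel u v -> hc_rel (total_map a u) (total_map a v).
Proof.
case=> [m n x y z c1 c2 t p t0|n x y c c' i t p cc' t1|n x y z c f t p t1|
  n x y c t]; rewrite /total_map/=.
- by rewrite achain_cat phi_map; exact: hc_rel_zero.
- by apply: hc_rel_one t1; exact: achain_contracts.
- by rewrite achain_cat; exact: hc_rel_last.
- by rewrite phi_based; exact: hc_rel_base.
Qed.

Lemma total_map_equiv a u v :
  hc_equiv F u v -> hc_equiv F (total_map a u) (total_map a v).
Proof.
move=> /asboolP uv; apply/asboolP.
elim: uv => {u v} [u v /total_map_rel uv|u|u v _ uv|u v w _ uv _].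
- exact: rst_step.
- exact: rst_refl.
- exact: rst_sym.
- exact: rst_trans.
Qed.

Definition hocolim_map (a : A) (u : hocolim F) : hocolim F :=
  \pi_({eq_quot hc_equiv F}) (total_map a (repr (u : {eq_quot hc_equiv F}))).

(** The representative chosen in [hocolim_map] is equivalent to [u], and [total_map] respects
    equivalence, so the choice does not matter. *)
Lemma hocolim_map_pi a u :
  hocolim_map a (\pi_({eq_quot hc_equiv F}) u) =
  \pi_({eq_quot hc_equiv F}) (total_map a u).
Proof. by apply/eqmodP/total_map_equiv/eqmodP; rewrite reprK. Qed.

Lemma hocolim_map_base a : hocolim_map a (hc_base F) = hc_base F.
Proof. exact: hocolim_map_pi. Qed.

Lemma hocolim_map_pt a n (x y : C) (c : chain n x y) (t : cube R n) (p : F x) :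
  hocolim_map a (hc_pt F c t p) = hc_pt F (achain psi (q a) c) t (phi a p).
Proof. exact: hocolim_map_pi. Qed.

Lemma hocolim_map_continuous a : continuous (hocolim_map a).
Proof.
apply/quotient_continuous.
(* By the universal property of the quotient topology, continuity is tested after composing with the
   projection. *)
rewrite (_ : _ \o _ = \pi_(hocolim F) \o total_map a); last first.
  by apply/funext => u; exact: hocolim_map_pi.
move=> u; apply: continuous_comp; first exact: total_map_continuous.
exact: pi_continuous.
Qed.

Lemma hocolim_map_action : top_action hocolim_map.
Proof.
split; first exact: hocolim_map_continuous.
- elim/hocolim_ind => [|n x y c t p]; first exact: hocolim_map_base.
  by rewrite hocolim_map_pt; apply: eq_hc_pt; rewrite ?q1 ?total_achain1.
- move=> a b; elim/hocolim_ind => [|n x y c t p].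
    by rewrite !hocolim_map_base.
  by rewrite !hocolim_map_pt; apply: eq_hc_pt; rewrite ?qM ?total_achainM.
Qed.

End Descent.

(** * Fibrewise form of the external action *)

Section External.
Context (R : realType) (G : finGroupType) (C : category).
Context (psi : cat_action G C) (F : hc_diagram R C).
Context (bar : external_action psi F).

(* The product of the wedge summands supplies continuous retractions of the
   wedge onto each of them. *)
Lemma ext_fib_continuous g c : continuous (@ext_fib _ _ _ _ _ bar g c).
Proof.
rewrite (_ : @ext_fib _ _ _ _ _ bar g c =
  proj (aob psi g c) \o @wedge_prod C (hc_space F) (fun=> point)
    \o ext_wedge bar g \o @in_dwedge R C F c); last first.
  apply/funext => p /=; rewrite ext_fibE /wedge_prod wedge_lift_funE.
    by rewrite /proj dfwithin.
  exact: wedge_prod_pointE.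
move=> p; apply: continuous_comp; first exact: wedge_lift_continuous.
apply: continuous_comp; first exact: (ta_cont (ext_action bar)).
apply: continuous_comp; first exact: wedge_prod_continuous.
exact: proj_continuous.
Qed.

(** [ext_based] names the basepoint through the summand at [c], whereas the image lies in the
    summand at $\psi_g c$; all basepoints agree in the wedge, and each summand injects into it. *)
Lemma ext_fib_based g c : ext_fib bar g (point : F c) = point.
Proof.
apply: in_dwedge_inj; rewrite -ext_fibE ext_based.
exact: in_dwedge_point.
Qed.

Lemma ext_fib1 c (p : F c) : in_dwedge (ext_fib bar 1%g p) = in_dwedge p.
Proof. by rewrite -ext_fibE (ta1 (ext_action bar)). Qed.

Lemma ext_fibM g h c (p : F c) :
  in_dwedge (ext_fib bar (g * h)%g p) =
  in_dwedge (ext_fib bar g (ext_fib bar h p)).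
Proof. by rewrite -!ext_fibE (taM (ext_action bar)). Qed.

End External.

(** The action of $K$ is fibrewise and based, so it descends to the wedge. This allows [kact] to be
    applied to both sides of [ext_fibM], whose points lie in fibres over provably equal objects. *)
Lemma in_dwedge_kact (K : finGroupType) (R : realType) (C : category)
    (F : hc_diagram R C) (kF : K_structure K F) k (c c' : C)
    (p : F c) (p' : F c') :
  in_dwedge p = in_dwedge p' ->
  in_dwedge (kact kF k p) = in_dwedge (kact kF k p').
Proof.
move=> /in_dwedge_eq[e|[-> ->]]; last first.
  by rewrite !kact_based; exact: in_dwedge_point.
have ec : c = c' := congr1 (@projT1 _ _) e.
by subst c'; rewrite (existT_inj2 e).
Qed.

Theorem proposition5p4 (R : realType) (G : finGroupType) (C : category)
    (psi : cat_action G C)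
    (bounded : exists N : nat,
       forall (n : nat) (x y : C), chain n x y -> (n <= N)%N) :
  (forall (F : hc_diagram R C) (bar : external_action psi F),
     exists a : G -> hocolim F -> hocolim F,
       [/\ top_action a,
           forall g, a g (hc_base F) = hc_base F &
           forall g n (x y : C) (c : chain n x y) (t : cube R n) (p : F x),
             a g (hc_pt F c t p) =
             hc_pt F (achain psi g c) t (ext_fib bar g p)])
  /\
  (forall (K : finGroupType) (abelianK : abelian [set: K])
     (F : hc_diagram R C) (kF : K_structure K F)
     (bar : external_action psi F) (comm : ext_commutes kF bar),
     exists a : (K * G)%type -> hocolim F -> hocolim F,
       [/\ top_action a,
           forall kg, a kg (hc_base F) = hc_base F &
           forall k g n (x y : C) (c : chain n x y) (t : cube R n) (p : F x),
             a (k, g) (hc_pt F c t p) =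
             hc_pt F (achain psi g c) t (kact kF k (ext_fib bar g p))]).
Proof.
split=> [F bar|K abelianK F kF bar comm].
  exists (hocolim_map (q := id) (ext_fib bar)).
  have based := @ext_fib_based _ _ _ _ _ bar.
  have map := @ext_map _ _ _ _ _ bar.
  split.
  - apply: hocolim_map_action => //; first exact: ext_fib_continuous.
      exact: ext_fib1.
    exact: ext_fibM.
  - by move=> g; exact: hocolim_map_base.
  - by move=> g n x y c t p; exact: hocolim_map_pt.
(* $K$ moves only the points of the fibres, hence [q] is [snd] below. *)
pose phi (a : (K * G)%type) c (p : F c) := kact kF a.1 (ext_fib bar a.2 p).
have based a c : phi a c point = point.
  by rewrite /phi ext_fib_based kact_based.
have map (a : (K * G)%type) n x y (c : chain n.+1 x y) t (p : F x) :
    phi a _ (hc_map F c t p) = hc_map F (achain psi a.2 c) t (phi a _ p).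
  by rewrite /phi ext_map kact_map.
exists (hocolim_map (q := snd) phi); split.
- apply: hocolim_map_action => //.
  + move=> a c p; apply: continuous_comp; first exact: ext_fib_continuous.
    exact: (ta_cont (kact_action kF _)).
  + by move=> c p; rewrite /phi (ta1 (kact_action kF _)) ext_fib1.
  (* Commutation moves $l$ past $g$: $k\,g\,(l\,h\,p)=(kl)\,(g\,h\,p)$, after which only the law for
     $G$ remains under [kact]. *)
  + move=> [k g] [l h] c p; rewrite /phi/= comm -(taM (kact_action kF _)).
    by apply: in_dwedge_kact; exact: ext_fibM.
- by move=> a; exact: hocolim_map_base.
- by move=> k g n x y c t p; exact: (hocolim_map_pt _ _ (k, g)).
Qed.
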